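(* We have \[ \liminf_{n\to\infty}\frac{C(n)}{n^2\log n}\geq\frac18, \qquad \liminf_{n\to\infty}\frac{D(n)}{n^{3/2}\sqrt{\log n}}\geq\frac{4}{3\sqrt3}, \] and \[ \liminf_{n\to\infty}\frac{\mu(n)}{\sqrt{n\log n}}\geq\frac12. \]
   Context: $\log$ is the natural logarithm. For an integer $n\geq1$, $\mathcal{M}_n$ is the set (repeated values counted once) of all multinomial coefficient values $\frac{n!}{p_1!\cdots p_t!}$, where $(p_1,\ldots,p_t)$ ranges over all integer partitions of $n$ ($p_1\geq\cdots\geq p_t\geq1$, $p_1+\cdots+p_t=n$). For an integer $t$, $r_n(t)=\#\{(x,y):x,y\in\mathcal{M}_n,\ x\leq y,\ x+y=t\}$. Define $C(n)=\sum_t\max(r_n(t)-1,0)$, $D(n)=\#\{t:r_n(t)\geq2\}$, and $\mu(n)=\max_t r_n(t)$. *)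

(* Defs.v *)
From mathcomp Require Import all_boot all_order all_algebra finmap.
From mathcomp Require Import all_classical all_reals all_analysis.

Set Implicit Arguments.
Unset Strict Implicit.
Unset Printing Implicit Defensive.

Local Open Scope classical_set_scope.
Local Open Scope nat_scope.

Definition is_partition (n : nat) (p : seq nat) : bool :=
  [&& sorted geq p, all (leq 1) p & sumn p == n].

(* The quotient is exact, see [dvdn_multinomial]. *)
Definition multinomial (p : seq nat) : nat :=
  (sumn p)`! %/ \prod_(i <- p) i`!.

Definition multinomials (n : nat) : set nat :=
  [set multinomial p | p in [set p : seq nat | is_partition n p]].

Definition rep_set (n : nat) (t : int) : set (nat * nat) :=
  [set xy | [/\ multinomials n xy.1, multinomials n xy.2, xy.1 <= xy.2
              & Posz (xy.1 + xy.2) = t]].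

(* [fset_set A] is empty, and a big operator over [setT] is the neutral element,
   when [A], respectively the support of the summand, is infinite. This never
   happens below: see [finite_rep_set], [finite_popular] and
   [finite_support_rep]. *)
Definition rep (n : nat) (t : int) : nat := #|` fset_set (rep_set n t)|.

(* The truncated [rep n t - 1] is max(rep n t - 1, 0). *)
Definition collisions (n : nat) : nat :=
  \big[addn/0]_(t \in [set: int]) (rep n t - 1).

Definition popular (n : nat) : set int := [set t | 2 <= rep n t].

Definition popular_count (n : nat) : nat := #|` fset_set (popular n)|.

Definition max_rep (n : nat) : nat :=
  \big[maxn/0]_(t \in [set: int]) rep n t.

Lemma dvdn_multinomial (p : seq nat) : \prod_(i <- p) i`! %| (sumn p)`!.
Proof.
elim: p => [|a p IHp] /=; first by rewrite big_nil.
rewrite big_cons -(bin_fact (leq_addr (sumn p) a)) addKn mulnC.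
by rewrite dvdn_mull // mulnC dvdn_mul.
Qed.

Lemma finite_multinomials (n : nat) : finite_set (multinomials n).
Proof.
apply: (sub_finite_set _ (finite_II n`!.+1)) => _ [p /and3P[_ _ /eqP <-] <-] /=.
by rewrite ltnS; exact: leq_div.
Qed.

Lemma finite_rep_set (n : nat) (t : int) : finite_set (rep_set n t).
Proof.
apply: (sub_finite_set _
  (finite_setX (finite_multinomials n) (finite_multinomials n))).
by move=> xy [].
Qed.

Lemma finite_support_rep (n : nat) : finite_set [set t | rep n t != 0].
Proof.
pose f (xy : nat * nat) : int := Posz (xy.1 + xy.2).
apply: (sub_finite_set _ (finite_image f
  (finite_setX (finite_multinomials n) (finite_multinomials n)))).
move=> t /=; rewrite /rep cardfs_eq0 => /fset0Pn[xy].
rewrite in_fset_set; last exact: finite_rep_set.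
by rewrite inE => -[mx my _ <-]; exists xy.
Qed.

Lemma finite_popular (n : nat) : finite_set (popular n).
Proof.
apply: (sub_finite_set _ (finite_support_rep n)) => t /=.
by rewrite /popular /=; case: (rep n t).
Qed.

Lemma leq_max_rep (n : nat) (t : int) : rep n t <= max_rep n.
Proof.
pose A := fset_set [set t | rep n t != 0].
have Amem u : (u \in A) = (rep n u != 0).
  rewrite in_fset_set; last exact: finite_support_rep.
  by apply/idP/idP; rewrite inE.
rewrite /max_rep (@fsbigTE _ _ _ _ A) => [|u]; last first.
  by rewrite Amem negbK => /eqP.
have [->//|rt] := eqVneq (rep n t) 0.
by apply: (@leq_bigmax_seq _ _ xpredT (rep n)) => //; rewrite Amem.
Qed.

Lemma max_rep_attained (n : nat) : exists t, max_rep n = rep n t.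
Proof.
have [m0|] := eqVneq (max_rep n) 0.
  by exists 0%R; apply/eqP; rewrite eqn_leq leq_max_rep m0.
pose A := fset_set [set t | rep n t != 0].
have -> : max_rep n = \max_(t <- A) rep n t.
  apply: fsbigTE => u.
  rewrite in_fset_set; last exact: finite_support_rep.
  by move=> /negP; rewrite inE /= => /negP; rewrite negbK => /eqP.
apply: (big_ind (fun m => m != 0 -> exists t, m = rep n t)) => //.
  by move=> x y IHx IHy; rewrite /maxn; case: ifP.
by move=> t _ _; exists t.
Qed.

(* Main.v *)
(** In [multinomials 5] one has 10 + 30 = 20 + 20. Adjoining a common list of
    parts to the partitions (3,2), (2,2,1), (3,1,1) of 5 scales this collision
    to [multinomials n], and letting the adjoined parts consist of i twos, j
    threes, k fives and ones already gives of the order of n^3 distinct popular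
    sums; this dominates both n^2 log n and n^(3/2) (log n)^(1/2).

    For the maximum, let W be the coefficient of a partition of n that contains
    the parts 0, ..., y twice, where y is of the order of sqrt n. Changing a
    part a to a - 1 and a part c - 1 to c multiplies the coefficient by a / c.
    Hence W = W a / c + W (c - a) / c is a representation of W whenever
    0 < a < c <= y, and there are as many representations as fractions a / c at
    most 1/2. The fractions a / (a b + 1) are pairwise distinct and there are of
    the order of y log y of them, which is of the order of sqrt n log n. *)

Require Import Defs.
From mathcomp Require Import all_boot all_order all_algebra.
From mathcomp Require Import all_classical all_reals all_analysis.
From mathcomp Require Import finmap zify ring lra.

Set Implicit Arguments.
Unset Strict Implicit.
Unset Printing Implicit Defensive.

Import Order.TTheory GRing.Theory Num.Theory.

Local Open Scope nat_scope.

(** * Counting by injections, and coefficients of unsorted lists *)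

Lemma leq_card_fset_set_inj (T : finType) (K : choiceType) (f : T -> K)
    (A : set K) :
  finite_set A -> injective f -> (forall x, A (f x)) ->
  #|T| <= #|` fset_set A|.
Proof.
move=> finA injf fA.
have -> : #|T| = #|` [fset f x | x in T]%fset|.
  by rewrite card_imfset //= -cardE.
apply: fsubset_leq_card; apply/fsubsetP => _ /imfsetP[x _ ->].
by rewrite in_fset_set //; exact: mem_set.
Qed.

Lemma multinomialK (p : seq nat) :
  multinomial p * \prod_(i <- p) i`! = (sumn p)`!.
Proof. by rewrite divnK // dvdn_multinomial. Qed.

Lemma prod_fact_gt0 (p : seq nat) : 0 < \prod_(i <- p) i`!.
Proof. by apply: prodn_gt0 => i; exact: fact_gt0. Qed.

Lemma multinomial_gt0 (p : seq nat) : 0 < multinomial p.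
Proof.
by have := fact_gt0 (sumn p); rewrite -multinomialK muln_gt0 => /andP[].
Qed.

(* Parts may be unsorted and zero, since zeros change neither the sum nor the
   product of factorials. *)
Lemma multinomials_sumn (p : seq nat) : multinomials (sumn p) (multinomial p).
Proof.
pose q := sort geq [seq i <- p | 0 < i].
have pq : perm_eq q [seq i <- p | 0 < i] by rewrite perm_sort.
have sq : sumn q = sumn p.
  rewrite (perm_sumn pq) !sumnE big_filter big_mkcond /=.
  by apply: eq_bigr => -[].
exists q.
  apply/and3P; split.
  - by apply: sort_sorted => x y /=; exact: leq_total.
  - by rewrite (perm_all _ pq); exact: filter_all.
  - by rewrite sq.
rewrite /multinomial sq (perm_big _ pq) big_filter big_mkcond /=.
by congr (_ %/ _); apply: eq_bigr => -[].
Qed.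

Lemma multinomials_intro (n : nat) (p : seq nat) (v : nat) :
  sumn p = n -> v * \prod_(i <- p) i`! = n`! -> multinomials n v.
Proof.
move=> <- vp; have -> : v = multinomial p.
  apply/eqP; rewrite -(eqn_pmul2r (prod_fact_gt0 p)) vp multinomialK.
  exact: eqxx.
exact: multinomials_sumn.
Qed.

(** * Popular sums and collisions *)

Lemma popular_scaled (n : nat) (q : seq nat) :
  sumn q + 5 = n -> popular n (Posz (4 * multinomial (3 :: 2 :: q))).
Proof.
move=> sq; set x := multinomial _.
have sn : sumn (3 :: 2 :: q) = n by rewrite /= -sq; lia.
have xK : x * \prod_(i <- 3 :: 2 :: q) i`! = n`! by rewrite multinomialK sn.
have x_gt0 : 0 < x by exact: multinomial_gt0.
have M1 : multinomials n x by rewrite -sn; exact: multinomials_sumn.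
have M2 : multinomials n (2 * x).
  apply: (@multinomials_intro _ (3 :: 1 :: 1 :: q)); first by rewrite /= -sq; lia.
  by rewrite -xK !big_cons !factS fact0; ring.
have M3 : multinomials n (3 * x).
  apply: (@multinomials_intro _ (2 :: 2 :: 1 :: q)); first by rewrite /= -sq; lia.
  by rewrite -xK !big_cons !factS fact0; ring.
rewrite /popular /= /rep -[leqLHS]card_bool; clearbody x.
apply: (@leq_card_fset_set_inj _ _
  (fun b : bool => if b then (x, 3 * x) else (2 * x, 2 * x))).
- exact: finite_rep_set.
- by move=> [] [] //= []; lia.
- by case; split => //=; lia.
Qed.

(** The bases are 2!, 3! and 5!. The valuations at 5, 3 and 2 form a triangular system that yields
    k, then j, then i. *)
Lemma smooth_inj (i j k i' j' k' : nat) :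
  2 ^ i * (6 ^ j * 120 ^ k) = 2 ^ i' * (6 ^ j' * 120 ^ k') ->
  [/\ i = i', j = j' & k = k'].
Proof.
move=> e.
have l p : i * logn p 2 + (j * logn p 6 + k * logn p 120) =
           i' * logn p 2 + (j' * logn p 6 + k' * logn p 120).
  by have := congr1 (logn p) e; rewrite !lognM ?muln_gt0 ?expn_gt0 // !lognX.
have := l 2; have := l 3; have := l 5.
have -> : 120 = 2 * 2 * 2 * 3 * 5 by [].
have -> : 6 = 2 * 3 by [].
rewrite !lognM // !logn_prime //=.
by move=> *; split; lia.
Qed.

Lemma popular_count_ge (n A : nat) :
  10 * A + 5 <= n -> A ^ 3 <= popular_count n.
Proof.
move=> hA.
pose r (u : 'I_A * 'I_A * 'I_A) := let: (i, j, k) := u in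
  n - 5 - (2 * i + 3 * j + 5 * k).
pose q (u : 'I_A * 'I_A * 'I_A) := let: (i, j, k) := u in
  nseq i 2 ++ nseq j 3 ++ nseq k 5 ++ nseq (r u) 1.
have sq u : sumn (q u) + 5 = n.
  case: u => [[i j] k] /=; rewrite !sumn_cat !sumn_nseq.
  by have := ltn_ord i; have := ltn_ord j; have := ltn_ord k; lia.
have pq u : \prod_(a <- q u) a`! =
    let: (i, j, k) := u in 2 ^ i * (6 ^ j * 120 ^ k).
  case: u => [[i j] k]; rewrite /q !big_cat !big_nseq !iter_muln_1 /=.
  have [-> -> -> ->] : [/\ 1`! = 1, 2`! = 2, 3`! = 6 & 5`! = 120] by [].
  by rewrite exp1n muln1.
have -> : A ^ 3 = #|{: 'I_A * 'I_A * 'I_A}|.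
  by rewrite !card_prod !card_ord; ring.
apply: (@leq_card_fset_set_inj _ _
  (fun u => Posz (4 * multinomial (3 :: 2 :: q u)))).
- exact: finite_popular.
- move=> u u' [/eqP]; rewrite eqn_pmul2l // => /eqP e.
  (* For a fixed sum, equal coefficients force equal products of factorials, and these determine i,
     j and k. *)
  have := multinomialK (3 :: 2 :: q u).
  have -> : sumn (3 :: 2 :: q u) = sumn (3 :: 2 :: q u').
    by rewrite /=; have := sq u; have := sq u'; lia.
  rewrite -multinomialK e => /eqP; rewrite eqn_pmul2l ?multinomial_gt0 //.
  rewrite !big_cons !eqn_pmul2l ?fact_gt0 // !pq => /eqP.
  case: u {e} => [[i j] k]; case: u' => [[i' j'] k'] /smooth_inj[].
  by move=> /val_inj -> /val_inj -> /val_inj ->.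
- by move=> u; exact: popular_scaled.
Qed.

(** Summands outside [popular n] vanish, and each one inside is at least 1. *)
Lemma leq_popular_collisions (n : nat) : popular_count n <= collisions n.
Proof.
rewrite /popular_count /collisions.
rewrite (@fsbigTE _ _ _ _ (fset_set (popular n))) => [|t]; last first.
  rewrite in_fset_set; last exact: finite_popular.
  by rewrite notin_setE /popular /=; lia.
rewrite -sum1_size big_seq [leqRHS]big_seq; apply: leq_sum => t.
rewrite in_fset_set; last exact: finite_popular.
by move=> /set_mem; rewrite /popular /=; lia.
Qed.

(** * Many representations of a single sum *)

(* Replacing the parts [a] and [c - 1] by [a - 1] and [c] multiplies the
   coefficient by [a / c]. *)
Lemma multinomials_frac (n y : nat) : y * y.+1 <= n ->
  exists2 W, 0 < W & forall a c, 0 < a <= y -> 0 < c <= y.+1 ->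
    c %| W * a /\ multinomials n (W * a %/ c).
Proof.
move=> hn; pose I := iota 0 y.+1; pose f := n - y * y.+1.
have sI : sumn I * 2 = y * y.+1.
  rewrite /I; elim: (y) => // z; rewrite -[in iota _ z.+2]addn1 iotaD sumn_cat /=.
  by lia.
(* Two copies of 0, ..., y allow removing a and c - 1 even when they coincide; [f] brings the sum up
   to n. *)
pose s := f :: I ++ I.
have ss : sumn s = n by rewrite /s -cat1s !sumn_cat [sumn [:: f]]addn0 /f; lia.
exists (multinomial s); first exact: multinomial_gt0.
move=> a c ha hc.
have aI : a \in I by rewrite mem_iota; lia.
have cI : c.-1 \in I by rewrite mem_iota; lia.
pose r := f :: rem a I ++ rem c.-1 I.
have pr : perm_eq s (a :: c.-1 :: r).
  rewrite /s /r perm_sym; apply/permP => P /=; rewrite !count_cat.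
  have := permP (perm_to_rem aI) P; have := permP (perm_to_rem cI) P => /=.
  by lia.
clearbody r.
pose p := a.-1 :: c :: r.
have sp : sumn p = n.
  by have := perm_sumn pr; rewrite ss /p /=; lia.
have e : multinomial s * a = multinomial p * c.
  have := multinomialK s; rewrite (perm_big _ pr) ss -sp -multinomialK /p.
  have fS k : 0 < k -> k`! = k * k.-1`! by case: k => // k _; rewrite factS.
  have /andP[a_gt0 _] := ha; have /andP[c_gt0 _] := hc.
  rewrite !big_cons (fS a) // (fS c) //.
  move: (fact_gt0 a.-1) (fact_gt0 c.-1) (prod_fact_gt0 r).
  move: (_`!) (_`!) (\prod_(_ <- r) _) => u v w u0 v0 w0 /= E.
  have uvw0 : 0 < u * v * w by rewrite !muln_gt0 u0 v0 w0.
  apply/eqP; rewrite -(eqn_pmul2r uvw0); apply/eqP.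
  transitivity (multinomial s * (a * v * (u * w))); first by ring.
  by rewrite E; ring.
rewrite e dvdn_mull // mulnK ?(proj1 (andP hc)) //; split => //.
by rewrite -sp; exact: multinomials_sumn.
Qed.

(* The equation is a / (a b + 1) = a' / (a' b' + 1), cross-multiplied. *)
Lemma frac_inj (a b a' b' : nat) : 0 < a -> 0 < a' ->
  a * (a' * b').+1 = a' * (a * b).+1 -> a = a' /\ b = b'.
Proof.
move=> a_gt0 a'_gt0 e.
have eb : b = b'.
  case: (ltngtP b b') => // lb.
    have : a * a' * b.+1 <= a * a' * b' by rewrite leq_mul2l lb orbT.
    by nia.
  have : a * a' * b'.+1 <= a * a' * b by rewrite leq_mul2l lb orbT.
  by nia.
by split => //; nia.
Qed.

Lemma max_rep_ge (n m : nat) : 32 * 4 ^ m <= n -> m.+1 * 2 ^ m <= max_rep n.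
Proof.
(* The denominators fit because a b <= 2^(i+1) (2^(m-i) + 1) <= 2^(m+2) = y. *)
move=> hn; pose y := 2 ^ m.+2.
have hy : y * y.+1 <= n.
  apply: leq_trans hn.
  rewrite (_ : 4 ^ m = 2 ^ m * 2 ^ m); last by rewrite -expnMn.
  by have : 0 < 2 ^ m by [rewrite expn_gt0]; rewrite /y !expnS; nia.
have [W W_gt0 WP] := multinomials_frac hy.
apply: leq_trans (leq_max_rep n (Posz W)).
(* The pairs (a, b) fill the dyadic boxes 2^i <= a < 2^(i+1),
   2 <= b < 2 + 2^(m-i), each of which has 2^m elements. *)
pose a (u : 'I_m.+1 * 'I_(2 ^ m)) := 2 ^ u.1 + u.2 %% 2 ^ u.1.
pose b (u : 'I_m.+1 * 'I_(2 ^ m)) := 2 + u.2 %/ 2 ^ u.1.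
pose c u := (a u * b u).+1.
have a_gt0 u : 0 < a u by rewrite /a addn_gt0 expn_gt0.
have a_lt (u : 'I_m.+1 * 'I_(2 ^ m)) : 2 ^ u.1 <= a u < 2 ^ u.1.+1.
  by rewrite /a leq_addr expnS mul2n -addnn ltn_add2l ltn_mod expn_gt0.
have c_le u : c u <= y.+1.
  have /andP[_ ha] := a_lt u.
  have hu : u.1 <= m by rewrite -ltnS.
  have hb : b u <= 2 ^ (m - u.1) + 1.
    by rewrite /b add2n addn1 ltnS ltn_divLR ?expn_gt0 // -expnD subnK.
  have : 2 ^ u.1 * 2 ^ (m - u.1) = 2 ^ m by rewrite -expnD subnKC.
  have : 2 ^ u.1 <= 2 ^ m by rewrite leq_exp2l.
  rewrite /c /y !expnS; move: ha; rewrite expnS ltnS => ha h1 h2.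
  have : a u * b u <= (2 * 2 ^ u.1) * (2 ^ (m - u.1) + 1) by apply: leq_mul; lia.
  by nia.
(* Since b >= 2, the fraction a / c lies below 1/2, which orders the two summands. *)
have a2c u : 2 * a u < c u.
  by rewrite /c ltnS mulnC leq_mul2l /b addSn ltnS addSn orbT.
have Wc u k : 0 < k <= y -> W * k %/ c u * c u = W * k.
  by move=> hk; rewrite divnK //; have [] := WP k (c u) hk (c_le u).
have ha u : 0 < a u <= y by have := a2c u; have := c_le u; have := a_gt0 u; lia.
have hca u : 0 < c u - a u <= y.
  by have := a2c u; have := c_le u; have := a_gt0 u; lia.
pose f u := (W * a u %/ c u, W * (c u - a u) %/ c u).
rewrite /rep -[m.+1]card_ord -[2 ^ m]card_ord -card_prod.
apply: (@leq_card_fset_set_inj _ _ f).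
- exact: finite_rep_set.
- move=> u u' [e _].
  have e1 := Wc u _ (ha u); have e2 := Wc u' _ (ha u').
  have [eab ebb] : a u = a u' /\ b u = b u'.
    apply: frac_inj => //; apply/eqP; rewrite -(eqn_pmul2l W_gt0); apply/eqP.
    by rewrite !mulnA -e1 -e2 e -!/(c _); lia.
  (* The box index is the binary logarithm of a; remainder and quotient then recover the second
     index. *)
  have e0 : u.1 = u'.1 :> nat.
    rewrite -(@trunc_log_eq 2 u.1 (a u)) ?a_lt // eab.
    by apply: trunc_log_eq => //; exact: a_lt.
  case: u u' {e e1 e2} eab ebb e0 => [i j] [i' j'] /= + + /val_inj ii'.
  rewrite -{}ii' /a /b /= => /addnI emod /addnI ediv; congr (_, _).
  by apply: val_inj; rewrite /= (divn_eq j (2 ^ i)) emod ediv -divn_eq.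
- move=> u; have [_ M1] := WP _ (c u) (ha u) (c_le u).
  have [_ M2] := WP _ (c u) (hca u) (c_le u).
  split => //=; first by apply: leq_div2r; rewrite leq_mul2l; have := a2c u; lia.
  congr Posz; apply/eqP; rewrite -(eqn_pmul2r (_ : 0 < c u)) // mulnDl !Wc //.
  by rewrite -mulnDr subnKC //; have := a2c u; lia.
Qed.

(** * Asymptotic comparison *)

Lemma trunc_log4_near (M : nat) :
  \forall n \near \oo%classic, M <= trunc_log 4 (n %/ 32).
Proof.
near=> n; apply: trunc_log_max => //; rewrite leq_divRL //.
by near: n; exact: nbhs_infty_ge.
Unshelve. all: by end_near. Qed.

Local Open Scope ring_scope.

Lemma le_limn_einf (R : realType) (u : (\bar R)^nat) (l : \bar R) :
  (\forall n \near \oo%classic, (l <= u n)%E) -> (l <= limn_einf u)%E.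
Proof.
move=> [N _ Nu]; rewrite limn_einf_lim; apply: lime_ge.
  exact: is_cvg_einfs.
exists N => // m /= Nm; apply: le_ereal_inf_tmp => _ /= [k mk <-].
by apply: Nu => /=; exact: leq_trans mk.
Qed.

(** With s the square root of x, ln x = 2 ln s <= 2 s, while 2 K <= s. *)
Lemma mul_ln_le (R : realType) (K x : R) :
  0 <= K -> 0 < x -> 4 * K ^+ 2 <= x -> K * ln x <= x.
Proof.
move=> K_ge0 x_gt0 Kx; set s := Num.sqrt x.
have s_gt0 : 0 < s by rewrite sqrtr_gt0.
have xs : x = s ^+ 2 by rewrite sqr_sqrtr // ltW.
have Ks : 2 * K <= s.
  rewrite -(ler_pXn2r (_ : 0 < 2)%N) ?nnegrE ?(ltW s_gt0) ?mulr_ge0 // -xs.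
  by rewrite exprMn (_ : 2 ^+ 2 = 4 :> R) // -natrX.
rewrite xs lnXn // mulr2n; have := ln_sublinear s_gt0 => h.
nra.
Qed.

Lemma ln_near (R : realType) (K : R) : 0 <= K ->
  \forall n \near \oo%classic, K * (1 + ln n%:R) <= n%:R :> R.
Proof.
move=> K_ge0; near=> n.
have n0 : 0 < n%:R :> R by rewrite ltr0n; near: n; exact: nbhs_infty_ge.
have K2 : 2 * K <= n%:R by near: n; exact: nbhs_infty_ger.
have : 2 * K * ln n%:R <= n%:R.
  apply: mul_ln_le => //; first by rewrite mulr_ge0.
  by near: n; exact: nbhs_infty_ger.
by lra.
Unshelve. all: by end_near. Qed.

(** One bound for both C(n) and D(n): the cubic count is at least (n/20)^3. The factor 1 + ln n
    dominates both ln n and its square root. *)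
Lemma popular_count_growth (R : realType) : \forall n \near \oo%classic,
  [/\ (1 < n)%N, 0 < ln n%:R :> R &
      4 / 3 * n%:R ^+ 2 * (1 + ln n%:R) <= (popular_count n)%:R :> R].
Proof.
near=> n.
have n28 : (28 <= n)%N by near: n; exact: nbhs_infty_ge.
have n1 : 1 < n%:R :> R by rewrite ltr1n; lia.
have ln_gt : 0 < ln n%:R :> R by exact: ln_gt0.
have ln_le : 4 / 3 * 20 ^+ 3 * (1 + ln n%:R) <= n%:R :> R.
  by near: n; apply: ln_near; rewrite mulr_ge0 ?exprn_ge0 ?divr_ge0.
split => //; first lia.
pose A := ((n - 5) %/ 10)%N.
have nA : (n <= 20 * A)%N by rewrite /A; lia.
have /popular_count_ge : (10 * A + 5 <= n)%N by rewrite /A; lia.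
rewrite -(ler_nat R) natrX; apply: le_trans.
have {}nA : n%:R / 20 <= A%:R :> R.
  by rewrite ler_pdivrMr // mulrC -natrM ler_nat.
have : (n%:R / 20) ^+ 3 <= A%:R ^+ 3 :> R.
  by rewrite lerXn2r ?nnegrE ?ler0n // divr_ge0.
apply: le_trans; rewrite expr_div_n ler_pdivlMr ?exprn_gt0 //.
move: (20 ^+ 3) ln_le => c ln_le.
rewrite [leRHS]exprSr.
rewrite (_ : 4 / 3 * _ * _ * c = n%:R ^+ 2 * (4 / 3 * c * (1 + ln n%:R))).
  by rewrite ler_wpM2l ?exprn_ge0.
by ring.
Unshelve. all: by end_near. Qed.

(** If 32 * 4^m <= n <= 128 * 4^m, then (m + 1) 2^m has order sqrt n log n; the spare factor
    sqrt(log n) absorbs the constants. *)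
Lemma max_rep_growth (R : realType) : \forall n \near \oo%classic,
  [/\ (1 < n)%N, 0 < ln n%:R :> R &
      Num.sqrt (n%:R * ln n%:R) <= 2 * (max_rep n)%:R :> R].
Proof.
near=> n.
have n32 : (32 <= n)%N by near: n; exact: nbhs_infty_ge.
have m150 : (150 <= trunc_log 4 (n %/ 32))%N.
  by near: n; exact: trunc_log4_near.
have n1 : 1 < n%:R :> R by rewrite ltr1n; lia.
have ln_gt : 0 < ln n%:R :> R by exact: ln_gt0.
split => //; first lia.
have := @trunc_log_bounds 4 (n %/ 32) isT; rewrite divn_gt0 // => /(_ n32).
move: (trunc_log _ _) m150 => m m150 /andP[].
rewrite leq_divRL // ltn_divLR // mulnC => /max_rep_ge mn.
have -> : (4 ^ m.+1 * 32 = 2 ^ (2 * m + 7))%N.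
  by rewrite expnD expnM expnS -[(2 ^ 2)%N]/4%N; lia.
move=> /ltnW; rewrite -(ler_nat R) natrX => n_le.
have ln_le : ln n%:R <= 2 * (2 * m + 7)%:R :> R.
  apply: (@le_trans _ _ (ln (2 ^+ (2 * m + 7)))).
    by rewrite ler_ln // posrE ?exprn_gt0 //; lra.
  rewrite lnXn // -[ln 2 *+ _]mulr_natr ler_wpM2r //.
  exact/ltW/ln_sublinear.
apply: (@le_trans _ _ (2 * (m.+1%:R * 2 ^+ m))); last first.
  by rewrite ler_wpM2l // -natrX -natrM ler_nat.
rewrite -[leRHS]ger0_norm; last by rewrite !mulr_ge0 ?exprn_ge0.
rewrite -sqrtr_sqr ler_sqrt ?exprn_ge0 ?mulr_ge0 ?exprn_ge0 //.
apply: (@le_trans _ _ (2 ^+ (2 * m + 7) * (2 * (2 * m + 7)%:R))).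
  by apply: ler_pM => //; lra.
have -> : 2 ^+ (2 * m + 7) = (2 ^+ m) ^+ 2 * 128 :> R.
  by rewrite exprD mulnC exprM; congr (_ * _); rewrite -natrX.
rewrite (_ : (2 * _) ^+ 2 = (2 ^+ m) ^+ 2 * (4 * m.+1%:R ^+ 2)); last by ring.
rewrite -[leLHS]mulrA ler_wpM2l ?exprn_ge0 //.
(* The quadratic wins here because m >= 150. *)
have : (64 * (2 * m + 7) <= m.+1 ^ 2)%N by nia.
rewrite -(ler_nat R) natrM natrX.
by lra.
Unshelve. all: by end_near. Qed.

Theorem theorem1p4 (R : realType) :
  [/\ ((1 / 8)%:E <=
        limn_einf (fun n : nat =>
          ((collisions n)%:R / (n%:R ^+ 2 * ln n%:R) : R)%:E))%E,
      ((4 / (3 * Num.sqrt 3))%:E <=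
        limn_einf (fun n : nat =>
          ((popular_count n)%:R
             / (n%:R `^ (3 / 2) * Num.sqrt (ln n%:R)) : R)%:E))%E
    & ((1 / 2)%:E <=
        limn_einf (fun n : nat =>
          ((max_rep n)%:R / Num.sqrt (n%:R * ln n%:R) : R)%:E))%E].
Proof.
split; apply: le_limn_einf.
- apply: filterS (popular_count_growth R) => n [n1 l0 h].
  have n0 : 0 < n%:R :> R by rewrite ltr0n; lia.
  have n2 : 0 < n%:R ^+ 2 :> R by rewrite exprn_gt0.
  rewrite lee_fin ler_pdivlMr ?mulr_gt0 //.
  have := leq_popular_collisions n; rewrite -(ler_nat R).
  by apply: le_trans; apply: (le_trans _ h); nra.
- apply: filterS (popular_count_growth R) => n [n1 l0 h].
  have n0 : 0 < n%:R :> R by rewrite ltr0n; lia.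
  rewrite lee_fin ler_pdivlMr ?mulr_gt0 ?powR_gt0 ?sqrtr_gt0 //.
  apply: (le_trans _ h); rewrite -[leRHS]mulrA.
  (* Factor by factor: 4 / (3 sqrt 3) <= 4/3, n^(3/2) <= n^2 and sqrt(ln n) <= 1 + ln n. *)
  apply: ler_pM.
  + by rewrite divr_ge0 // mulr_ge0 // sqrtr_ge0.
  + by rewrite mulr_ge0 ?powR_ge0 ?sqrtr_ge0.
  + have s1 : 1 <= Num.sqrt 3 :> R by rewrite -[leLHS]sqrtr1 ler_sqrt // ler1n.
    rewrite ler_pdivlMr // mulrAC ler_pdivrMr; last by lra.
    by lra.
  + apply: ler_pM; rewrite ?powR_ge0 ?sqrtr_ge0 //.
      rewrite -powR_mulrn ?(ltW n0) // ler_powR //; last by lra.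
      by rewrite ler1n; lia.
    have -> : 1 + ln n%:R = Num.sqrt ((1 + ln n%:R) ^+ 2) :> R.
      by rewrite sqrtr_sqr ger0_norm // addr_ge0 // ltW.
    by rewrite ler_sqrt ?exprn_ge0 ?addr_ge0 ?(ltW l0) //; nra.
- apply: filterS (max_rep_growth R) => n [n1 l0 h].
  have n0 : 0 < n%:R :> R by rewrite ltr0n; lia.
  rewrite lee_fin ler_pdivlMr ?sqrtr_gt0 ?mulr_gt0 //.
  by lra.
Qed.
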